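(* If $G$ is a triangle-free graph of order $n$ with minimum degree at least $4$, then $\iota(G) \le \frac{3}{10} n$.
   Context: Graphs are finite and simple. A set $S \subseteq V(G)$ is an isolating set of $G$ if $G - N[S]$ has no edge (i.e., every edge of $G$ has an endpoint in the closed neighborhood $N[S]$); the isolation number $\iota(G)$ is the minimum size of an isolating set of $G$. *)

(* Defs.v *)
From mathcomp Require Import all_boot all_order all_algebra.

Set Implicit Arguments.
Unset Strict Implicit.
Unset Printing Implicit Defensive.

(* A finite simple graph is a symmetric irreflexive relation e on a finType. *)
Section Graph.
Variables (T : finType) (e : rel T).

Definition nbhd (v : T) : {set T} := [set w | e v w].

Definition deg (v : T) : nat := #|nbhd v|.

Definition closed_nbhd (S : {set T}) : {set T} := S :|: \bigcup_(v in S) nbhd v.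

Definition triangle_free : bool :=
  [forall x, forall y, forall z, ~~ [&& e x y, e y z & e x z]].

Definition isolating (S : {set T}) : bool :=
  [forall x in ~: closed_nbhd S, forall y in ~: closed_nbhd S, ~~ e x y].

Lemma isolatingT : isolating setT.
Proof. by apply/forall_inP => x; rewrite inE /closed_nbhd setTU inE. Qed.

Definition isolation_number : nat :=
  #|[arg min_(S < [set: T] | isolating S) #|S|]|.

Lemma isolation_numberP :
  (exists2 S, isolating S & #|S| = isolation_number) /\
  (forall S, isolating S -> isolation_number <= #|S|).
Proof.
rewrite /isolation_number; case: arg_minnP; first exact: isolatingT.
by move=> S isoS minS; split=> //; exists S.
Qed.

End Graph.

(* Main.v *)
Require Import Defs.
From mathcomp Require Import all_boot all_order all_algebra.
From mathcomp Require Import zify.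

(** For a set B of vertices let d_B(x) be the number of neighbours of x in B,
    and put P(B) = 36|B| + sum over w outside B of f(d_B(w)), where f takes the
    values 0, 8, 12, 15, 18, 18, ...  We show by induction on |B| that the edges
    inside B can be isolated by some X with 120|X| <= P(B); taking B = V gives
    |X| <= 36n/120.

    The induction removes a part Z of B at the price of a few vertices X,
    provided that P drops by at least 120|X|.  This is possible as long as a
    vertex of B has degree at least 3 in B, or a vertex outside B has too many
    neighbours in B, or sees too many of the K2- and C5-components of B.
    Otherwise B induces paths and cycles, which can be isolated with one vertex
    out of three, except that a K2 needs 1 vertex and a C5 needs 2; since all
    degrees are at least 4, the edges leaving B carry enough of P to pay for it.
*)

Set Implicit Arguments.
Unset Strict Implicit.
Unset Printing Implicit Defensive.

Section Isolation.
Variables (T : finType) (e : rel T).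
Hypothesis e_sym : symmetric e.
Hypothesis tri_free : triangle_free e.
Implicit Types (B X Z : {set T}) (u v w x y z : T).

Local Notation N := (nbhd e).
Local Notation Nc := (closed_nbhd e).

(** * Closed neighbourhoods and isolation inside a vertex set *)

Lemma no_triangle x y z : e x y -> e y z -> e x z -> False.
Proof.
move=> xy yz xz; move/forallP/(_ x)/forallP/(_ y)/forallP/(_ z): tri_free.
by rewrite xy yz xz.
Qed.

Lemma edge_irr x : e x x = false.
Proof. by apply/negP => xx; apply: (no_triangle xx xx xx). Qed.

Lemma edge_neq x y : e x y -> x != y.
Proof. by apply: contraTneq => ->; rewrite edge_irr. Qed.

Lemma in_nbhd x y : (y \in N x) = e x y.
Proof. by rewrite inE. Qed.

Lemma closed_nbhdP X u :
  reflect (u \in X \/ exists2 v, v \in X & e v u) (u \in Nc X).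
Proof.
rewrite inE; apply: (iffP orP) => -[uX|]; try by left.
  by case/bigcupP => v vX; rewrite in_nbhd => vu; right; exists v.
by case=> v vX vu; right; apply/bigcupP; exists v; rewrite ?in_nbhd.
Qed.

Lemma closed_nbhd_self X u : u \in X -> u \in Nc X.
Proof. by move=> uX; apply/closed_nbhdP; left. Qed.

Lemma closed_nbhd_edge X v u : v \in X -> e v u -> u \in Nc X.
Proof. by move=> vX vu; apply/closed_nbhdP; right; exists v. Qed.

Lemma closed_nbhdS X X' : X \subset X' -> Nc X \subset Nc X'.
Proof.
move=> /subsetP sX; apply/subsetP => u /closed_nbhdP [/sX|[v /sX vX vu]].
  exact: closed_nbhd_self.
exact: closed_nbhd_edge vu.
Qed.

(** The set [X] may lie outside [B]; only edges with both ends in [B] have to be met. *)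
Definition isolates X B :=
  forall u v, u \in B -> v \in B -> e u v -> u \in Nc X \/ v \in Nc X.

(** This is what allows [Z] to be deleted from [B]: every edge of [B] with an end in [Z] then has an
    end in [Nc X]. *)
Definition settled X B Z :=
  forall z, z \in Z ->
    z \in Nc X \/ (forall u, u \in B -> e z u -> u \in Nc X).

Lemma isolates_settled X X' B Z :
  settled X B Z -> isolates X' (B :\: Z) -> isolates (X :|: X') B.
Proof.
move=> sZ iX u v uB vB uv.
have sub1 := subsetP (closed_nbhdS (subsetUl X X')).
have sub2 := subsetP (closed_nbhdS (subsetUr X X')).
have [uZ|uZ] := boolP (u \in Z).
  by case: (sZ _ uZ) => [/sub1|/(_ _ vB uv)/sub1]; [left|right].
have [vZ|vZ] := boolP (v \in Z).
  case: (sZ _ vZ) => [/sub1|]; first by right.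
  by rewrite e_sym in uv; move/(_ _ uB uv)/sub1; left.
have uBZ : u \in B :\: Z by rewrite inE uZ.
have vBZ : v \in B :\: Z by rewrite inE vZ.
by case: (iX u v uBZ vBZ uv) => /sub2; [left|right].
Qed.

(** * Degrees inside a vertex set *)

Definition deg_in B x := #|N x :&: B|.

Lemma deg_inS B B' x : B \subset B' -> deg_in B x <= deg_in B' x.
Proof. by move=> sB; apply/subset_leq_card/setIS. Qed.

Lemma deg_in_gt0 B x y : y \in B -> e x y -> 0 < deg_in B x.
Proof. by move=> yB xy; apply/card_gt0P; exists y; rewrite !inE xy. Qed.

Lemma deg_in_gt0P B x : 0 < deg_in B x -> exists2 y, y \in B & e x y.
Proof. by case/card_gt0P => y; rewrite !inE => /andP [xy yB]; exists y. Qed.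

Lemma deg_in1 B x y u :
  deg_in B x <= 1 -> y \in B -> e x y -> u \in B -> e x u -> u = y.
Proof.
move=> dx yB xy uB xu; apply/eqP; apply/negPn/negP => neq.
have : #|[set u; y]| <= deg_in B x.
  apply/subset_leq_card/subsetP => v; rewrite !inE.
  by case/orP => /eqP ->; apply/andP.
by rewrite cards2 neq; move: dx; case: deg_in => [|[]].
Qed.

Lemma deg_in2 B x y z u : deg_in B x <= 2 -> y \in B -> z \in B -> y != z ->
  e x y -> e x z -> u \in B -> e x u -> u = y \/ u = z.
Proof.
move=> dx yB zB neq xy xz uB xu.
have [->|uy] := eqVneq u y; first by left.
have [->|uz] := eqVneq u z; first by right.
have : #|[set u; y; z]| <= deg_in B x.
  apply/subset_leq_card/subsetP => v; rewrite !inE.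
  by case/orP => [/orP [] /eqP ->|/eqP ->]; apply/andP.
rewrite setUC cardsU1 cards2 !inE uy eq_sym (negbTE uz) eq_sym (negbTE neq) /=.
by move=> h; move: (leq_trans h dx).
Qed.

Lemma deg_in2_other B x y : deg_in B x = 2 -> y \in B -> e x y ->
  exists z, [/\ z \in B, z != y & e x z].
Proof.
move=> dx yB xy.
have : 0 < #|(N x :&: B) :\ y|.
  by move: dx; rewrite /deg_in (cardsD1 y) !inE xy yB; case: #|_|.
by case/card_gt0P => z; rewrite !inE => /and3P [zy xz zB]; exists z.
Qed.

Lemma deg_in_pred B Z x y :
  y \in B -> y \in Z -> e x y -> deg_in (B :\: Z) x < deg_in B x.
Proof.
move=> yB yZ xy; apply/proper_card/properP; split; first exact/setIS/subsetDl.
by exists y; rewrite !inE ?xy ?yB ?yZ.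
Qed.

Lemma deg_in_setD B Z x :
  deg_in B x = deg_in (B :\: Z) x + #|N x :&: (B :&: Z)|.
Proof.
rewrite /deg_in -(cardsID Z (N x :&: B)) addnC; congr (_ + _).
  by apply: eq_card => u; rewrite !inE; case: (u \in Z); rewrite ?andbF.
by apply: eq_card => u; rewrite !inE andbA.
Qed.

Lemma deg_in_setD_id B Z x :
  (forall z, z \in Z -> z \in B -> ~~ e x z) -> deg_in (B :\: Z) x = deg_in B x.
Proof.
move=> h; rewrite (deg_in_setD B Z) [X in _ + X](_ : _ = 0) ?addn0 //.
apply/eqP; rewrite cards_eq0; apply/eqP/setP => u; rewrite !inE.
by apply/negP => /and3P [xu uB uZ]; move: (h u uZ uB); rewrite xu.
Qed.

Lemma deg_in_setD0 B Z x :
  (forall u, u \in B -> e x u -> u \in Z) -> deg_in (B :\: Z) x = 0.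
Proof.
move=> h; apply/eqP; rewrite cards_eq0; apply/eqP/setP => u; rewrite !inE.
by apply/negP => /and3P [xu /negP uZ uB]; apply: uZ; apply: h.
Qed.

(** Double counting of the edges between [A] and [C], each weighted at its end in [C]. *)
Lemma exchange_edges (A C : {set T}) (f : T -> nat) :
  \sum_(w in A) \sum_(x in N w :&: C) f x = \sum_(x in C) f x * #|N x :&: A|.
Proof.
rewrite (exchange_big_dep (fun x => x \in C)) /=; last first.
  by move=> w x _; rewrite inE => /andP [].
apply: eq_bigr => x xC; rewrite sum_nat_const mulnC; congr (_ * _).
by apply: eq_card => w; rewrite [LHS]unfold_in !inE xC andbT andbC e_sym.
Qed.


(** * K2-components and pentagons *)

Definition isK2 B x :=
  [exists y, [&& y \in B, e x y, deg_in B x == 1 & deg_in B y == 1]].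

Definition pentagon B x a b c d :=
  [&& [&& x \in B, a \in B, b \in B, c \in B & d \in B],
      e x a, e a b, e b c, e c d & e d x].

(* If all degrees in B are at most 2, this says that x lies in a C5-component. *)
Definition isC5 B x :=
  [exists a, exists b, exists c, exists d, pentagon B x a b c d].

Lemma isK2P B x :
  reflect (exists y, [/\ y \in B, e x y, deg_in B x = 1 & deg_in B y = 1])
          (isK2 B x).
Proof.
apply: (iffP existsP) => -[y].
  by case/and4P => yB xy /eqP dx /eqP dy; exists y.
by case=> yB xy dx dy; exists y; rewrite yB xy dx dy.
Qed.

Lemma pentagonP B x a b c d :
  reflect ([/\ x \in B, a \in B, b \in B, c \in B & d \in B] /\
           [/\ e x a, e a b, e b c, e c d & e d x])
          (pentagon B x a b c d).
Proof.
apply: (iffP andP) => -[].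
  by move/and5P => [? ? ? ? ?] /and5P [].
by case=> ? ? ? ? ? h; split; apply/and5P.
Qed.

Lemma isC5P B x :
  reflect (exists a b c d, pentagon B x a b c d) (isC5 B x).
Proof.
apply: (iffP existsP) => -[a].
  by case/existsP => b /existsP [c /existsP [d]]; exists a, b, c, d.
case=> b [c [d p]]; exists a.
by apply/existsP; exists b; apply/existsP; exists c; apply/existsP; exists d.
Qed.

Lemma pentagon_rot B x a b c d : pentagon B x a b c d -> pentagon B a b c d x.
Proof. by case/pentagonP => -[? ? ? ? ?] [? ? ? ? ?]; apply/pentagonP. Qed.

Lemma pentagon_rev B x a b c d : pentagon B x a b c d -> pentagon B x d c b a.
Proof.
case/pentagonP => -[? ? ? ? ?] [? ? ? ? ?]; apply/pentagonP.
by split; split=> //; rewrite e_sym.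
Qed.

(** Since [isC5] does not mention degrees, a deletion can never create a new pentagon, whereas it
    may create a new K2. *)
Lemma isC5S B B' x : B \subset B' -> isC5 B x -> isC5 B' x.
Proof.
move/subsetP => sB /isC5P [a [b [c [d /pentagonP [[xB aB bB cB dB] h]]]]].
apply/isC5P; exists a, b, c, d; apply/pentagonP.
by split=> //; split; apply: sB.
Qed.

(* A closed walk of length five in a triangle-free graph is a cycle. *)
Lemma pentagon_uniq B x a b c d :
  pentagon B x a b c d -> uniq [:: x; a; b; c; d].
Proof.
case/pentagonP => _ [xa ab bc cd dx] /=; rewrite !inE !negb_or.
have nb p q r : e p q -> e q r -> e r p -> False.
  by move=> pq qr rp; apply: (no_triangle pq qr); rewrite e_sym.
(* If [p] and [r] coincided, the three remaining edges would form the triangle [p], [s], [t]. *)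
have neq p q r s t : e p q -> e q r -> e r s -> e s t -> e t p -> p != r.
  by move=> pq qr rs st tp; apply/eqP => E; subst r; apply: (nb p s t).
rewrite (edge_neq xa) (edge_neq ab) (edge_neq bc) (edge_neq cd).
rewrite [x == d]eq_sym (edge_neq dx).
rewrite (neq x a b c d) // [x == c]eq_sym (neq c d x a b) //.
by rewrite (neq a b c d x) // [a == d]eq_sym (neq d x a b c) // (neq b c d x a).
Qed.

Lemma pentagon_deg B x a b c d : pentagon B x a b c d -> 2 <= deg_in B x.
Proof.
move=> p; have /pentagonP [[xB aB bB cB dB] [xa ab bc cd dx]] := p.
have ad : a != d.
  by move: (pentagon_uniq p); rewrite /= !inE !negb_or => /and3P [_ /and3P []].
have <- : #|[set a; d]| = 2 by rewrite cards2 ad.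
apply/subset_leq_card/subsetP => u /set2P [] ->; rewrite !inE ?xa //.
by rewrite e_sym dx.
Qed.

Lemma pentagon_nbhd B x a b c d u : pentagon B x a b c d ->
  deg_in B x <= 2 -> u \in B -> e x u -> u = a \/ u = d.
Proof.
move=> p; have /pentagonP [[xB aB bB cB dB] [xa ab bc cd dx]] := p.
have ad : a != d.
  by move: (pentagon_uniq p); rewrite /= !inE !negb_or => /and3P [_ /and3P []].
by move=> deg2 uB; apply: deg_in2 deg2 aB dB ad xa _ uB; rewrite e_sym.
Qed.

Definition set5 x a b c d : {set T} := [set u in [:: x; a; b; c; d]].

Lemma set5P x a b c d u :
  reflect [\/ u = x, u = a, u = b | u = c \/ u = d] (u \in set5 x a b c d).
Proof.
rewrite !inE; apply: (iffP or4P).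
  case=> [/eqP|/eqP|/eqP|/orP [] /eqP] ->;
    by [apply: Or41|apply: Or42|apply: Or43|
        apply: Or44; left|apply: Or44; right].
case=> [->|->|->|[] ->]; rewrite eqxx ?orbT;
  by [apply: Or41|apply: Or42|apply: Or43|apply: Or44].
Qed.

Lemma set5_rot x a b c d : set5 x a b c d = set5 a b c d x.
Proof. by apply/setP => u; rewrite !inE orbC -!orbA. Qed.

Lemma card_pentagon B x a b c d :
  pentagon B x a b c d -> #|set5 x a b c d| = 5.
Proof. by move/pentagon_uniq/card_uniqP => U; rewrite cardsE U. Qed.

Lemma pentagon_sub B x a b c d :
  pentagon B x a b c d -> set5 x a b c d \subset B.
Proof.
case/pentagonP => -[xB aB bB cB dB] _.
by apply/subsetP => u /set5P [->|->|->|[->|->]].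
Qed.

Lemma pentagon_isC5 B x a b c d u :
  pentagon B x a b c d -> u \in set5 x a b c d -> isC5 B u.
Proof.
move=> p /set5P us; apply/isC5P.
have p1 := pentagon_rot p; have p2 := pentagon_rot p1.
have p3 := pentagon_rot p2; have p4 := pentagon_rot p3.
case: us => [->|->|->|[->|->]].
- by exists a, b, c, d.
- by exists b, c, d, x.
- by exists c, d, x, a.
- by exists d, x, a, b.
- by exists x, a, b, c.
Qed.

Lemma isC5_deg B x : isC5 B x -> 2 <= deg_in B x.
Proof. by case/isC5P => a [b [c [d]]]; apply: pentagon_deg. Qed.

(** The two cycle neighbours of each vertex already exhaust its degree in [B], so the pentagon is a
    whole component. *)
Lemma pentagon_closed B x a b c d z u :
  (forall y, y \in B -> deg_in B y <= 2) ->
  pentagon B x a b c d -> z \in set5 x a b c d -> u \in B -> e z u ->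
  u \in set5 x a b c d.
Proof.
move=> deg2 p /set5P zs uB.
have first y a' b' c' d' : pentagon B y a' b' c' d' -> e y u ->
    u \in set5 y a' b' c' d'.
  move=> q yu; have /pentagonP [[yB _ _ _ _] _] := q.
  by case: (pentagon_nbhd q (deg2 y yB) uB yu) => ->; rewrite !inE eqxx ?orbT.
have p1 := pentagon_rot p; have p2 := pentagon_rot p1.
have p3 := pentagon_rot p2; have p4 := pentagon_rot p3.
case: zs => [->|->|->|[->|->]]; first exact: first.
- by move/(first _ _ _ _ _ p1); rewrite -set5_rot.
- by move/(first _ _ _ _ _ p2); rewrite -2!set5_rot.
- by move/(first _ _ _ _ _ p3); rewrite -3!set5_rot.
- by move/(first _ _ _ _ _ p4); rewrite -4!set5_rot.
Qed.

(** * Sets inducing paths and cycles *)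

(** A chosen vertex costs 120: a K2 pays 2 * 60 for one, a C5 pays 5 * 48 for two, and elsewhere
    three vertices pay 3 * 40 for one. *)
Definition weight B x := if isK2 B x then 60 else if isC5 B x then 48 else 40.

Lemma weight_ge B x : 40 <= weight B x.
Proof. by rewrite /weight; case: ifP => // _; case: ifP. Qed.

Lemma weight_isC5 B x : isC5 B x -> 48 <= weight B x.
Proof. by rewrite /weight => ->; case: ifP. Qed.

Lemma weight_setD B Z x :
  (isK2 (B :\: Z) x -> isK2 B x) -> weight (B :\: Z) x <= weight B x.
Proof.
move=> h; rewrite /weight; case: ifP => [/h -> //|_].
case: ifP => [/(isC5S (subsetDl _ _)) ->|_]; first by case: ifP.
by case: ifP => // _; case: ifP.
Qed.

(** When no edge joins [Z] to the rest of [B], the deletion changes no degree in the rest. *)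
Lemma isK2_setD B Z x :
  (forall y z, y \in B -> y \notin Z -> z \in Z -> z \in B -> ~~ e y z) ->
  x \in B :\: Z -> isK2 (B :\: Z) x -> isK2 B x.
Proof.
move=> h; rewrite inE => /andP [xZ xB] /isK2P [y []].
rewrite inE => /andP [yZ yB] xy.
have id u : u \in B -> u \notin Z -> deg_in (B :\: Z) u = deg_in B u.
  by move=> uB uZ; apply: deg_in_setD_id => z zZ zB; apply: h.
by rewrite !id // => dx dy; apply/isK2P; exists y.
Qed.

(** Induction on the size of [B], removing in turn a K2, a C5, the first three vertices of a path,
    or three consecutive vertices of a cycle. The only danger is a newly created K2, whose weights
    would rise; it arises from a path on five vertices, which is removed whole, or from a C5, which
    is already gone. *)
Lemma isolates_sum_weight B :
  (forall x, x \in B -> deg_in B x <= 2) ->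
  exists2 X, isolates X B & 120 * #|X| <= \sum_(x in B) weight B x.
Proof.
have [n] := ubnP #|B|; elim: n B => // n IHn B leBn deg2.
have reduce X Z : Z \subset B -> Z != set0 -> settled X B Z ->
    (forall x, x \in B :\: Z -> isK2 (B :\: Z) x -> isK2 B x) ->
    120 * #|X| <= \sum_(x in Z) weight B x ->
    exists2 X, isolates X B & 120 * #|X| <= \sum_(x in B) weight B x.
  move=> ZB Z0 sZ K2Z leX.
  have ltBZ : #|B :\: Z| < n.
    rewrite -ltnS; apply: leq_trans leBn; rewrite ltnS -(cardsID Z B).
    by rewrite (setIidPr ZB) -[X in X < _]add0n ltn_add2r card_gt0.
  have deg2Z x : x \in B :\: Z -> deg_in (B :\: Z) x <= 2.
    rewrite inE => /andP [_ xB].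
    by apply: leq_trans (deg2 x xB); apply/deg_inS/subsetDl.
  have [X' isoX' leX'] := IHn _ ltBZ deg2Z.
  exists (X :|: X'); first exact: isolates_settled isoX'.
  rewrite (big_setID Z) /= (setIidPr ZB).
  have leW : \sum_(x in B :\: Z) weight (B :\: Z) x
             <= \sum_(x in B :\: Z) weight B x.
    by apply: leq_sum => x xBZ; apply: weight_setD; apply: K2Z.
  have := cardsU X X'; lia.
have [/existsP [x /andP [xB xK]]|noK] :=
    boolP [exists x, (x \in B) && isK2 B x].
  have /isK2P [y [yB xy dx dy]] := xK.
  have yx : e y x by rewrite e_sym.
  have yK : isK2 B y by apply/isK2P; exists x.
  apply: (reduce [set x] [set x; y]).
  - by rewrite subUset !sub1set xB.
  - by apply/set0Pn; exists x; rewrite !inE eqxx.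
  - move=> z /set2P [] ->; left.
      by apply: closed_nbhd_self; rewrite inE.
    by apply: closed_nbhd_edge xy; rewrite inE.
  - move=> u; apply: isK2_setD => {}u z uB uZ zZ zB.
    rewrite e_sym; apply: contra uZ => zu; move: zZ; rewrite !inE.
    case/orP => /eqP E; subst z.
      by rewrite (deg_in1 _ yB xy uB zu) ?dx // eqxx orbT.
    by rewrite (deg_in1 _ xB yx uB zu) ?dy // eqxx.
  rewrite big_setU1 ?inE ?(edge_neq xy) // big_set1 cards1.
  by rewrite /weight xK yK.
have {}noK x : x \in B -> ~~ isK2 B x.
  by move=> xB; apply: contra noK => xK; apply/existsP; exists x; rewrite xB.
have [/existsP [x /andP [xB xC]]|noC] :=
    boolP [exists x, (x \in B) && isC5 B x].
  have /isC5P [a [b [c [d p]]]] := xC.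
  have /pentagonP [[_ aB bB cB dB] [xa ab bc cd dx]] := p.
  (* Two vertices at distance two dominate the whole cycle. *)
  apply: (reduce [set x; b] (set5 x a b c d)).
  - exact: pentagon_sub p.
  - by apply/set0Pn; exists x; rewrite !inE eqxx.
  - have xX : x \in [set x; b] by rewrite !inE eqxx.
    have bX : b \in [set x; b] by rewrite !inE eqxx orbT.
    move=> z /set5P zs; left; case: zs => [->|->|->|[->|->]].
    + exact: closed_nbhd_self.
    + exact: closed_nbhd_edge xa.
    + exact: closed_nbhd_self.
    + exact: closed_nbhd_edge bc.
    + by apply: closed_nbhd_edge xX _; rewrite e_sym.
  - move=> u; apply: isK2_setD => {}u z uB uZ zZ zB.
    by rewrite e_sym; apply: contra uZ; apply: (pentagon_closed deg2 p zZ uB).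
  have le2 : #|[set x; b]| <= 2 by rewrite cards2; case: (x != b).
  apply: (@leq_trans (\sum_(u in set5 x a b c d) 48)).
    by rewrite sum_nat_const (card_pentagon p) (@leq_pmul2l 120 _ 2).
  by apply: leq_sum => u /(pentagon_isC5 p) /weight_isC5.
have {}noC x : x \in B -> ~~ isC5 B x.
  by move=> xB; apply: contra noC => xC; apply/existsP; exists x; rewrite xB.
have esym p q : e p q -> e q p by rewrite e_sym.
have sum_ge Z : 40 * #|Z| <= \sum_(x in Z) weight B x.
  by rewrite mulnC -sum_nat_const; apply: leq_sum => x _; apply: weight_ge.
(* A vertex of degree 1 starts a path [v1], [v2], [v3], as there are no K2-components; choosing [v2]
   removes these three. *)
have [/existsP [v1 /andP [v1B /eqP d1]]|noL] :=
    boolP [exists x, (x \in B) && (deg_in B x == 1)].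
  have [|v2 v2B e12] := @deg_in_gt0P B v1; first by rewrite d1.
  have e21 := esym _ _ e12.
  have d2 : deg_in B v2 = 2.
    have := deg_in_gt0 v1B e21; have := deg2 _ v2B.
    have : deg_in B v2 != 1.
      by apply: contra (noK _ v1B) => /eqP d2; apply/isK2P; exists v2.
    by case: deg_in => [|[|[]]].
  have [v3 [v3B n31 e23]] := deg_in2_other d2 v1B e21.
  have e32 := esym _ _ e23.
  have n12 := edge_neq e12; have n23 := edge_neq e23.
  have N1 u : u \in B -> e v1 u -> u = v2.
    by apply: deg_in1 => //; rewrite d1.
  have N2 u : u \in B -> e v2 u -> u = v1 \/ u = v3.
    move=> uB; apply: deg_in2 (deg2 _ v2B) v1B v3B _ e21 e23 uB.
    by rewrite eq_sym.
  pose Z := [set v1; v2; v3].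
  have mem3 z : z \in Z -> [\/ z = v1, z = v2 | z = v3].
    by rewrite !inE -orbA => /or3P [] /eqP;
      [apply: Or31|apply: Or32|apply: Or33].
  have ZB : Z \subset B by rewrite !subUset !sub1set v1B v2B v3B.
  have Z0 : Z != set0 by apply/set0Pn; exists v1; rewrite !inE eqxx.
  have cardZ : #|Z| = 3.
    by rewrite /Z setUC cardsU1 cards2 !inE negb_or n31 n12 [v3 == _]eq_sym n23.
  have [/existsP [p /andP [pBZ pK]]|noKZ] :=
      boolP [exists x, (x \in B :\: Z) && isK2 (B :\: Z) x]; last first.
    apply: (reduce [set v2] Z) => //.
    - move=> z /mem3 zs; left; case: zs => ->.
      + by apply: closed_nbhd_edge e21; rewrite inE.
      + by apply: closed_nbhd_self; rewrite inE.
      + by apply: closed_nbhd_edge e23; rewrite inE.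
    - by move=> x xBZ xK; case/existsP: noKZ; exists x; apply/andP.
    by rewrite cards1; apply: leq_trans (sum_ge _); rewrite cardZ.
  (* Here the deletion leaves a new K2 whose end [x] has lost a neighbour. That neighbour is [v3],
     so the component is the path [v1], [v2], [v3], [x], [y], and its middle vertex isolates it. *)
  have P5 x y : x \in B :\: Z -> y \in B :\: Z -> e x y ->
      deg_in (B :\: Z) x = 1 -> deg_in (B :\: Z) y = 1 -> deg_in B x != 1 ->
      exists2 X, isolates X B & 120 * #|X| <= \sum_(x in B) weight B x.
    move=> xBZ yBZ xy dx dy nx; have yx := esym _ _ xy.
    have /setDP [xB xZ] := xBZ; have /setDP [yB yZ] := yBZ.
    have onlyv3 u z : u \in B -> u \notin Z -> z \in Z -> e u z -> z = v3.
      move=> uB uZ /mem3 [] // E /esym zu; subst z.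
        by case/negP: uZ; rewrite !inE (N1 u) ?eqxx ?orbT.
      by case/negP: uZ; case: (N2 u) => // ->; rewrite !inE eqxx ?orbT.
    have e3x : e v3 x.
      apply: contraNT nx => n3x; rewrite -dx eq_sym; apply/eqP.
      apply: deg_in_setD_id => z zZ zB; apply/negP => xz.
      by case/negP: n3x; rewrite e_sym -(onlyv3 x z).
    have n2x : v2 != x by apply: contra xZ => /eqP <-; rewrite !inE eqxx ?orbT.
    have N3 u : u \in B -> e v3 u -> u = v2 \/ u = x.
      exact: deg_in2 (deg2 _ v3B) v2B xB n2x e32 e3x.
    have Nx u : u \in B -> e x u -> u = v3 \/ u = y.
      move=> uB xu; have [uZ|uZ] := boolP (u \in Z).
        by left; apply: onlyv3 xu.
      have uBZ : u \in B :\: Z by rewrite inE uZ.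
      by right; apply: (deg_in1 _ yBZ xy uBZ xu); rewrite dx.
    have Ny u : u \in B -> e y u -> u = x.
      move=> uB yu; have [uZ|uZ] := boolP (u \in Z).
        have E := onlyv3 _ _ yB yZ uZ yu; subst u.
        case: (N3 y) => // [|E|E]; first exact: esym.
          by case/negP: yZ; rewrite E !inE eqxx ?orbT.
        by move: xy; rewrite E edge_irr.
      have uBZ : u \in B :\: Z by rewrite inE uZ.
      by apply: (deg_in1 _ xBZ yx uBZ yu); rewrite dy.
    have in5 z : z \in Z :|: [set x; y] ->
        [\/ z = v1, z = v2, z = v3 | z = x \/ z = y].
      case/setUP => [/mem3 []|/set2P]; [exact: Or41|exact: Or42|exact: Or43|].
      exact: Or44.
    apply: (reduce [set v3] (Z :|: [set x; y])).
    - by rewrite subUset ZB subUset !sub1set xB.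
    - by apply/set0Pn; exists x; rewrite !inE eqxx ?orbT.
    - have v3X : v3 \in [set v3] by rewrite inE.
      have v2X := closed_nbhd_edge v3X e32; have xX := closed_nbhd_edge v3X e3x.
      move=> z /in5 [|||[]] ->.
      + by right=> u uB /(N1 u uB) ->.
      + by left.
      + by left; apply: closed_nbhd_self.
      + by left.
      + by right=> u uB /(Ny u uB) ->.
    - move=> u; apply: isK2_setD => {}u z uB uZ /in5 zs zB.
      apply/negP => /esym zu; case/negP: uZ.
      case: zs => [|||[]] E; subst z.
      + by rewrite (N1 u) // !inE eqxx ?orbT.
      + by case: (N2 u) => // ->; rewrite !inE eqxx ?orbT.
      + by case: (N3 u) => // ->; rewrite !inE eqxx ?orbT.
      + by case: (Nx u) => // ->; rewrite !inE eqxx ?orbT.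
      + by rewrite (Ny u) // !inE eqxx ?orbT.
    rewrite cards1; apply: leq_trans (sum_ge _).
    apply: (@leq_trans (40 * 3)) => //.
    by rewrite leq_pmul2l // -cardZ; apply/subset_leq_card/subsetUl.
  have /isK2P [q [qBZ pq dp dq]] := pK.
  have /setDP [pB _] := pBZ; have /setDP [qB _] := qBZ.
  (* One of [p] and [q] must have lost a neighbour, or they would form a K2-component of [B]. *)
  have [dBp|/(P5 p q)] := eqVneq (deg_in B p) 1; last exact.
  have [dBq|/(P5 q p)] := eqVneq (deg_in B q) 1; last first.
    by apply=> //; apply: esym.
  by case/negP: (noK _ pB); apply/isK2P; exists q.
(* All degrees are now 0 or 2. If 2 does not occur, [B] has no edge and the empty set works. *)
have [/existsP [v /andP [vB /eqP dv]]|noE] :=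
    boolP [exists x, (x \in B) && (deg_in B x == 2)]; last first.
  exists set0; last by rewrite cards0.
  move=> u v uB vB uv; have := deg_in_gt0 vB uv; have := deg2 _ uB.
  have : deg_in B u != 1.
    by apply: contra noL => du; apply/existsP; exists u; rewrite uB.
  have : deg_in B u != 2.
    by apply: contra noE => du; apply/existsP; exists u; rewrite uB.
  by case: deg_in => [|[|[]]].
have [|a aB va] := @deg_in_gt0P B v; first by rewrite dv.
have [b [bB nba vb]] := deg_in2_other dv aB va.
have Nv u : u \in B -> e v u -> u = a \/ u = b.
  by apply: deg_in2 (deg2 _ vB) aB bB _ va vb; rewrite eq_sym.
pose Z := [set v; a; b].
have mem3 z : z \in Z -> [\/ z = v, z = a | z = b].
  by rewrite !inE -orbA => /or3P [] /eqP; [apply: Or31|apply: Or32|apply: Or33].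
apply: (reduce [set v] Z).
- by rewrite !subUset !sub1set vB aB.
- by apply/set0Pn; exists v; rewrite !inE eqxx.
- move=> z /mem3 zs; left; case: zs => ->.
  + by apply: closed_nbhd_self; rewrite inE.
  + by apply: closed_nbhd_edge va; rewrite inE.
  + by apply: closed_nbhd_edge vb; rewrite inE.
- move=> x xBZ /isK2P [y [yBZ xy dx dy]].
  (* Such a [u] lost a neighbour in [Z], and this is not [v]. So both ends of a new K2 are attached
     to [a] or [b]: to the same one gives a triangle, to different ones a C5 through [v]. *)
  have attached u : u \in B :\: Z -> deg_in (B :\: Z) u = 1 -> e u a \/ e u b.
    case/setDP => uB uZ du.
    have : deg_in B u != 1.
      by apply: contra noL => du'; apply/existsP; exists u; rewrite uB.
    have [ua|nua] := boolP (e u a); first by left.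
    have [ub|nub] := boolP (e u b); first by right.
    rewrite -du -(deg_in_setD_id (Z := Z)) ?eqxx // => z /mem3 [] -> // _.
    apply: contra uZ => /esym vu.
    by case: (Nv u) => // ->; rewrite !inE eqxx ?orbT.
  have /setDP [xB _] := xBZ; have /setDP [yB _] := yBZ.
  case/negP: (noC v vB); apply/isC5P.
  case: (attached x xBZ dx) => xa; case: (attached y yBZ dy) => ya.
  + by case: (no_triangle xy ya xa).
  + exists a, x, y, b; apply/pentagonP.
    by split; split=> //; apply: esym.
  + exists b, x, y, a; apply/pentagonP.
    by split; split=> //; apply: esym.
  + by case: (no_triangle xy ya xa).
rewrite cards1; apply: leq_trans (sum_ge _).
rewrite /Z setUC cardsU1 cards2 !inE negb_or nba (edge_neq va).
by rewrite eq_sym (edge_neq vb).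
Qed.

(** * The potential and its change under a deletion *)

Hypothesis min_deg : forall v, 4 <= deg e v.

Lemma deg_out B x : 4 <= deg_in B x + #|N x :&: ~: B|.
Proof. by rewrite /deg_in -setDE cardsID; apply: min_deg. Qed.

(* Up to scale the first values are forced: removing a vertex of degree 4 of B
   needs 120 + 4 charge 3 <= 5 * 36, removing one of degree 3 needs
   120 + 3 charge 2 <= 4 * 36 + 4 (charge 3 - charge 2), and a vertex with two
   neighbours in C5-components needs charge 2 >= 12. *)
Definition charge k := nth 18 [:: 0; 8; 12; 15] k.

Lemma charge_le18 k : charge k <= 18.
Proof. by case: k => [|[|[|[|[|k]]]]]. Qed.

Lemma charge_ge4 k : 4 <= k -> charge k = 18.
Proof. by case: k => [|[|[|[|[|k]]]]]. Qed.

Lemma leq_charge j k : j <= k -> charge j <= charge k.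
Proof.
have [/charge_ge4 -> _|] := leqP 4 k; first exact: charge_le18.
by case: k => [|[|[|[|k]]]] //; case: j => [|[|[|[|j]]]].
Qed.

(** The increments of [charge] up to 4 are 8, 4, 3, 3; beyond 4 it is constant. *)
Lemma charge_gap i j : i + j <= 4 -> charge i + 3 * j <= charge (i + j).
Proof. by case: i => [|[|[|[|[|i]]]]]; case: j => [|[|[|[|[|j]]]]]. Qed.

Definition potential B := 36 * #|B| + \sum_(w in ~: B) charge (deg_in B w).

Definition good B := exists2 X, isolates X B & 120 * #|X| <= potential B.

Definition good_below B := forall B', #|B'| < #|B| -> good B'.

(** The deleted vertices give up 36 each but join the outside, where they are charged at most [a] in
    total; the old outside vertices release at least [g]. *)
Lemma potential_setD B Z a g : Z \subset B ->
  \sum_(z in Z) charge (deg_in (B :\: Z) z) <= a ->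
  g + \sum_(w in ~: B) charge (deg_in (B :\: Z) w)
    <= \sum_(w in ~: B) charge (deg_in B w) ->
  potential (B :\: Z) + 36 * #|Z| + g <= potential B + a.
Proof.
move=> ZB lea leg; rewrite /potential.
have <- : #|B :\: Z| + #|Z| = #|B|.
  by rewrite -(cardsID Z B) (setIidPr ZB) addnC.
rewrite (big_setID Z) /=.
have -> : ~: (B :\: Z) :&: Z = Z.
  by apply/setP => u; rewrite !inE negb_and negbK; case: (u \in Z);
    rewrite ?andbF.
have -> : ~: (B :\: Z) :\: Z = ~: B.
  apply/setP => u; rewrite !inE negb_and negbK.
  by have := subsetP ZB u; case: (u \in Z) => //= ->.
lia.
Qed.

Lemma good_reduce B X Z a g : good_below B -> Z \subset B -> 0 < #|Z| ->
  settled X B Z ->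
  \sum_(z in Z) charge (deg_in (B :\: Z) z) <= a ->
  g + \sum_(w in ~: B) charge (deg_in (B :\: Z) w)
    <= \sum_(w in ~: B) charge (deg_in B w) ->
  120 * #|X| + a <= 36 * #|Z| + g -> good B.
Proof.
move=> IH ZB Z0 sZ lea leg le.
have [|X' isoX' leX'] := IH (B :\: Z).
  by rewrite -(cardsID Z B) (setIidPr ZB) -[X in X < _]add0n ltn_add2r.
exists (X :|: X'); first exact: isolates_settled isoX'.
have := potential_setD ZB lea leg; have := cardsU X X'; lia.
Qed.

(** The vertices of [Z0] keep no neighbour in the remaining set and so are charged nothing. *)
Lemma sum_charge_le B Z Z0 j : Z0 \subset Z ->
  (forall z u, z \in Z0 -> u \in B -> e z u -> u \in Z) ->
  (forall z, z \in Z -> z \notin Z0 -> deg_in (B :\: Z) z <= j) ->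
  \sum_(z in Z) charge (deg_in (B :\: Z) z) <= charge j * #|Z :\: Z0|.
Proof.
move=> Z0Z closed0 degj; rewrite (big_setID Z0) /= (setIidPr Z0Z).
rewrite big1 ?add0n => [|z zZ0]; last first.
  by rewrite deg_in_setD0 // => u; apply: closed0.
rewrite mulnC -sum_nat_const; apply: leq_sum => z /setDP [zZ zZ0].
exact/leq_charge/degj.
Qed.

(** The leading [0] is the gain [g] expected by [good_reduce]. *)
Lemma charge_out_mono B Z :
  0 + \sum_(w in ~: B) charge (deg_in (B :\: Z) w)
    <= \sum_(w in ~: B) charge (deg_in B w).
Proof. by apply: leq_sum => w _; apply/leq_charge/deg_inS/subsetDl. Qed.

(** Once all its neighbours in [B] are deleted, [w] releases its whole charge. *)
Lemma charge_out_vertex B Z w : w \notin B ->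
  (forall u, u \in B -> e w u -> u \in Z) ->
  charge (deg_in B w) + \sum_(u in ~: B) charge (deg_in (B :\: Z) u)
    <= \sum_(u in ~: B) charge (deg_in B u).
Proof.
move=> wB closedw; have wC : w \in ~: B by rewrite inE.
rewrite (bigD1 w wC) /= [X in _ <= X](bigD1 w wC) /=.
rewrite (deg_in_setD0 closedw) add0n leq_add2l.
by apply: leq_sum => u _; apply/leq_charge/deg_inS/subsetDl.
Qed.

(** By [charge_gap], each edge from [Z] to the outside of [B] releases at least 3. *)
Lemma charge_out_edges B Z : Z \subset B ->
  (forall w, w \notin B -> deg_in B w <= 4) ->
  3 * \sum_(z in Z) #|N z :&: ~: B|
    + \sum_(w in ~: B) charge (deg_in (B :\: Z) w)
    <= \sum_(w in ~: B) charge (deg_in B w).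
Proof.
move=> ZB deg4.
have -> : \sum_(z in Z) #|N z :&: ~: B| = \sum_(w in ~: B) #|N w :&: Z|.
  rewrite -[RHS](eq_bigr _ (fun w _ => sum1_card _)) exchange_edges.
  by apply: eq_bigr => z _; rewrite mul1n.
rewrite big_distrr -big_split /=; apply: leq_sum => w; rewrite inE => wB.
have := deg4 _ wB; rewrite (deg_in_setD B Z) (setIidPr ZB).
by rewrite [3 * _ + _]addnC; apply: charge_gap.
Qed.

(** * Reductions at vertices of large degree *)

(** Choose [v] and delete it with its neighbours. Each neighbour loses [v], so by maximality it
    keeps degree less than that of [v]. *)
Lemma good_deg_ge4 B v : good_below B -> v \in B -> 4 <= deg_in B v ->
  (forall u, u \in B -> deg_in B u <= deg_in B v) -> good B.
Proof.
move=> IH vB dv maxv.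
pose Z := v |: (N v :&: B).
have vN : v \notin N v :&: B by rewrite !inE edge_irr.
have cardZ : #|Z| = (deg_in B v).+1 by rewrite cardsU1 vN.
have ZB : Z \subset B by rewrite subUset sub1set vB subsetIr.
have cardZv : #|Z :\: [set v]| = deg_in B v.
  by move: cardZ; rewrite (cardsD1 v) !inE eqxx => -[].
apply: (@good_reduce B [set v] Z
  (charge (deg_in B v).-1 * deg_in B v) 0) => //.
- by rewrite cardZ.
- move=> z /setU1P [->|/setIP [vz _]]; left.
    by apply: closed_nbhd_self; rewrite inE.
  by apply: (@closed_nbhd_edge _ v); rewrite ?inE // -in_nbhd.
- rewrite -[X in _ * X]cardZv; apply: sum_charge_le.
  + by rewrite sub1set !inE eqxx.
  + by move=> z u /set1P -> uB vu; rewrite !inE vu uB orbT.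
  + move=> z /setU1P [->|]; first by rewrite inE eqxx.
    rewrite in_setI in_nbhd e_sym => /andP [zv zB] _.
    have vZ : v \in Z by rewrite !inE eqxx.
    have := maxv _ zB; have := deg_in_pred vB vZ zv; lia.
- exact: charge_out_mono.
rewrite cardZ cards1; move: dv; move: (deg_in B v) => d dv.
(* Degree 4 gives the equality 120 + 15 * 4 = 36 * 5; from 5 on, 120 + 18 d <= 36 (d + 1). *)
have [->|n4] := eqVneq d 4; first by [].
rewrite charge_ge4; lia.
Qed.

(** Choose [w] and delete its d neighbours in [B], each charged at most 15: 120 + 15 d <= 36 d + 18
    holds from d = 5 on. *)
Lemma good_out_ge5 B w : good_below B ->
  (forall u, u \in B -> deg_in B u <= 3) ->
  w \notin B -> 5 <= deg_in B w -> good B.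
Proof.
move=> IH deg3 wB dw; pose Z := N w :&: B.
apply: (@good_reduce B [set w] Z
  (charge 3 * #|Z :\: set0|) (charge (deg_in B w))) => //.
- exact: subsetIr.
- exact: leq_trans dw.
- move=> z /setIP [wz _]; left.
  by apply: (@closed_nbhd_edge _ w); rewrite ?inE // -in_nbhd.
- apply: sum_charge_le => [|z u|z]; rewrite ?sub0set ?inE //.
  move=> /andP [_ zB] _; apply: leq_trans (deg3 z zB).
  exact/deg_inS/subsetDl.
- by apply: charge_out_vertex => // u uB wu; rewrite !inE wu.
rewrite setD0 cards1 (charge_ge4 (ltnW dw)) /charge /=.
by move: dw; rewrite /deg_in -/Z; lia.
Qed.

(** Each of the four deleted vertices has an edge leaving [B], which releases 3. The balance is
    tight: 120 + 3 * 12 = 4 * 36 + 4 * 3. *)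
Lemma good_deg3 B v : good_below B ->
  (forall u, u \in B -> deg_in B u <= 3) ->
  (forall w, w \notin B -> deg_in B w <= 4) ->
  v \in B -> deg_in B v = 3 -> good B.
Proof.
move=> IH deg3 deg4 vB dv.
pose Z := v |: (N v :&: B).
have vN : v \notin N v :&: B by rewrite !inE edge_irr.
have cardZ : #|Z| = 4 by rewrite cardsU1 vN -/(deg_in B v) dv.
have ZB : Z \subset B by rewrite subUset sub1set vB subsetIr.
have cardZv : #|Z :\: [set v]| = 3.
  by move: cardZ; rewrite (cardsD1 v) !inE eqxx => -[].
apply: (@good_reduce B [set v] Z
  (charge 2 * 3) (3 * \sum_(z in Z) #|N z :&: ~: B|)) => //.
- by rewrite cardZ.
- move=> z /setU1P [->|/setIP [vz _]]; left.
    by apply: closed_nbhd_self; rewrite inE.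
  by apply: (@closed_nbhd_edge _ v); rewrite ?inE // -in_nbhd.
- rewrite -[X in _ * X]cardZv; apply: sum_charge_le.
  + by rewrite sub1set !inE eqxx.
  + by move=> z u /set1P -> uB vu; rewrite !inE vu uB orbT.
  + move=> z /setU1P [->|]; first by rewrite inE eqxx.
    rewrite in_setI in_nbhd e_sym => /andP [zv zB] _.
    have vZ : v \in Z by rewrite !inE eqxx.
    have := deg3 _ zB; have := deg_in_pred vB vZ zv; lia.
- exact: charge_out_edges.
have : #|Z| <= \sum_(z in Z) #|N z :&: ~: B|.
  rewrite -sum1_card; apply: leq_sum => z /(subsetP ZB) zB.
  have := deg3 _ zB; have := deg_out B z; lia.
rewrite cardZ cards1 /charge /=; lia.
Qed.

(** * Reductions and discharging when all inner degrees are at most 2 *)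

Section DegreeTwo.
Variable B : {set T}.
Hypothesis IH : good_below B.
Hypothesis deg2 : forall x, x \in B -> deg_in B x <= 2.

Lemma deg2_setD Z z : z \in B -> deg_in (B :\: Z) z <= 2.
Proof. by move=> zB; apply: leq_trans (deg2 zB); apply/deg_inS/subsetDl. Qed.

(** Choosing [w] also settles the partner [y] of [x], so [y] is deleted along with the neighbours of
    [w], and neither [x] nor [y] is charged. *)
Lemma good_K2_many w x : w \notin B -> 3 <= deg_in B w <= 4 ->
  x \in B -> e w x -> isK2 B x -> good B.
Proof.
move=> wB dw xB wx /isK2P [y [yB xy dx dy]].
have yx : e y x by rewrite e_sym.
have ywN : y \notin N w :&: B.
  by rewrite !inE yB andbT; apply/negP => wy; apply: (no_triangle wx xy wy).
pose Z := y |: (N w :&: B).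
have xZ : x \in Z by rewrite !inE wx xB orbT.
have yZ : y \in Z by rewrite !inE eqxx.
have cardZ : #|Z| = (deg_in B w).+1 by rewrite cardsU1 ywN.
have Z0Z : [set x; y] \subset Z by rewrite subUset !sub1set xZ yZ.
have cardZ0 : #|Z :\: [set x; y]| = (deg_in B w).-1.
  by rewrite cardsD (setIidPr Z0Z) cards2 (edge_neq xy) cardZ subn2.
apply: (@good_reduce B [set w] Z
  (charge 2 * (deg_in B w).-1) (charge (deg_in B w))) => //.
- by rewrite subUset sub1set yB subsetIr.
- by rewrite cardZ.
- have wX : w \in [set w] by rewrite inE.
  move=> z /setU1P [->|/setIP [wz _]].
    right=> u uB yu; rewrite (deg_in1 _ xB yx uB yu) ?dy //.
    exact: closed_nbhd_edge wx.
  by left; apply: closed_nbhd_edge wX _; rewrite -in_nbhd.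
- rewrite -[X in _ * X]cardZ0; apply: sum_charge_le => //.
    move=> z u /set2P [] -> uB zu.
      by rewrite (deg_in1 _ yB xy uB zu) ?dx.
    by rewrite (deg_in1 _ xB yx uB zu) ?dy.
  move=> z /setU1P [->|/setIP [_ zB]]; first by rewrite !inE eqxx orbT.
  by move=> _; apply: deg2_setD.
- by apply: charge_out_vertex => // u uB wu; rewrite !inE wu uB orbT.
rewrite cardZ cards1; move: dw.
by case: (deg_in B w) => [|[|[|[|[|d]]]]].
Qed.

(** The vertex [w] settles both components at once. Whole components are deleted, so nothing is
    charged, and 120 <= 4 * 36. *)
Lemma good_K2_K2 w x x' : x \in B -> x' \in B -> x != x' ->
  e w x -> e w x' -> isK2 B x -> isK2 B x' -> good B.
Proof.
move=> xB xB' neq wx wx' /isK2P [y [yB xy dx dy]] /isK2P [y' [yB' xy' dx' dy']].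
have yx : e y x by rewrite e_sym.
have yx' : e y' x' by rewrite e_sym.
have U : uniq [:: x; x'; y; y'].
  rewrite /= !inE !negb_or neq (edge_neq xy) (edge_neq xy') /= !andbT.
  apply/and3P; split.
  - by apply/eqP => E; apply: (no_triangle wx' xy'); rewrite -E.
  - by apply/eqP => E; apply: (no_triangle wx xy); rewrite -E.
  - apply/eqP => E; subst y'; case/eqP: neq.
    by apply: (deg_in1 _ xB' yx' xB yx); rewrite dy.
pose Z := [set u in [:: x; x'; y; y']].
have ZP u : u \in Z -> [\/ u = x, u = x', u = y | u = y'].
  by rewrite !inE => /or4P [] /eqP ->;
    [apply: Or41|apply: Or42|apply: Or43|apply: Or44].
have cardZ : #|Z| = 4 by rewrite cardsE (card_uniqP U).
have memZ : [/\ x \in Z, x' \in Z, y \in Z & y' \in Z].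
  by rewrite !inE !eqxx ?orbT.
have [xZ xZ' yZ yZ'] := memZ.
apply: (@good_reduce B [set w] Z
  (charge 2 * #|Z :\: Z|) 0) => //.
- by apply/subsetP => u /ZP [] ->.
- by rewrite cardZ.
- have wX : w \in [set w] by rewrite inE.
  have xX := closed_nbhd_edge wX wx; have xX' := closed_nbhd_edge wX wx'.
  move=> z /ZP [] ->; try by left.
    by right=> u uB yu; rewrite (deg_in1 _ xB yx uB yu) ?dy.
  by right=> u uB yu; rewrite (deg_in1 _ xB' yx' uB yu) ?dy'.
- apply: sum_charge_le => // [z u /ZP zs uB zu|z ->] //.
  case: zs => E; subst z.
  + by rewrite (deg_in1 _ yB xy uB zu) ?dx.
  + by rewrite (deg_in1 _ yB' xy' uB zu) ?dx'.
  + by rewrite (deg_in1 _ xB yx uB zu) ?dy.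
  + by rewrite (deg_in1 _ xB' yx' uB zu) ?dy'.
- exact: charge_out_mono.
by rewrite setDv cards0 cardZ cards1.
Qed.

(** Only [d] may be undominated, and its neighbours [c] and [x] are dominated by [b] and [w]. *)
Lemma pentagon_settled w x a b c d : e w x -> pentagon B x a b c d ->
  settled [set w; b] B (set5 x a b c d).
Proof.
move=> wx p; have /pentagonP [[xB aB bB cB dB] [xa ab bc cd dx]] := p.
have wX : w \in [set w; b] by rewrite !inE eqxx.
have bX : b \in [set w; b] by rewrite !inE eqxx orbT.
have xX := closed_nbhd_edge wX wx; have cX := closed_nbhd_edge bX bc.
move=> z /set5P [->|->|->|[->|->]]; try by left.
- by left; apply: closed_nbhd_edge bX _; rewrite e_sym.
- by left; apply: closed_nbhd_self.
- have p4 : pentagon B d x a b c by do 4! apply: pentagon_rot.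
  by right=> u uB du; case: (pentagon_nbhd p4 (deg2 dB) uB du) => ->.
Qed.

(** Two vertices settle seven, again without any charge: 240 <= 7 * 36. *)
Lemma good_K2_C5 w x c : x \in B -> e w x -> e w c ->
  isK2 B x -> isC5 B c -> good B.
Proof.
move=> xB wx wc /isK2P [y [yB xy dx dy]] /isC5P [c1 [c2 [c3 [c4 p]]]].
have yx : e y x by rewrite e_sym.
pose C := set5 c c1 c2 c3 c4; pose Z := [set x; y] :|: C.
have notC u : deg_in B u = 1 -> u \notin C.
  by move=> du; apply/negP => /(pentagon_isC5 p) /isC5_deg; rewrite du.
have cardZ : #|Z| = 7.
  rewrite cardsU (_ : _ :&: C = set0) ?cards0 ?subn0.
    by rewrite cards2 (edge_neq xy) (card_pentagon p).
  apply/setP => u; rewrite in_setI in_set0; apply/negP.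
  by case/andP => /set2P [] ->; apply/negP; apply: notC.
apply: (@good_reduce B [set w; c2] Z
  (charge 2 * #|Z :\: Z|) 0) => //.
- by rewrite !subUset !sub1set xB yB (pentagon_sub p).
- by rewrite cardZ.
- have wX : w \in [set w; c2] by rewrite !inE eqxx.
  have xX := closed_nbhd_edge wX wx.
  move=> z /setUP [/set2P [] ->|]; first by left.
    by right=> u uB yu; rewrite (deg_in1 _ xB yx uB yu) ?dy.
  exact: pentagon_settled.
- apply: sum_charge_le => // [z u zZ uB zu|z ->] //.
  case/setUP: zZ => [/set2P [] E|zC]; try subst z.
  + by rewrite (deg_in1 _ yB xy uB zu) ?dx // !inE eqxx orbT.
  + by rewrite (deg_in1 _ xB yx uB zu) ?dy // !inE eqxx.
  + by apply/setUP; right; apply: (pentagon_closed deg2 p zC uB).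
- exact: charge_out_mono.
by rewrite setDv cards0 cardZ cards2; case: (w != c2).
Qed.

(** The vertex [a] between [x] and [b] is settled by [w] because both its neighbours are dominated,
    so it can be deleted uncharged. *)
Lemma good_C5_twice w x a b c d : w \notin B -> 3 <= deg_in B w <= 4 ->
  pentagon B x a b c d -> e w x -> e w b -> good B.
Proof.
move=> wB dw p wx wb; have /pentagonP [[xB aB bB cB dB] [xa ab bc cd dx]] := p.
have awN : a \notin N w :&: B.
  by rewrite !inE aB andbT; apply/negP => wa; apply: (no_triangle wx xa wa).
pose Z := a |: (N w :&: B).
have cardZ : #|Z| = (deg_in B w).+1 by rewrite cardsU1 awN.
have Na u : u \in B -> e a u -> u = b \/ u = x.
  exact: (pentagon_nbhd (pentagon_rot p) (deg2 aB)).
have cardZ0 : #|Z :\: [set a]| = deg_in B w.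
  by move: cardZ; rewrite (cardsD1 a) !inE eqxx => -[].
apply: (@good_reduce B [set w] Z
  (charge 2 * deg_in B w) (charge (deg_in B w))) => //.
- by rewrite subUset sub1set aB subsetIr.
- by rewrite cardZ.
- have wX : w \in [set w] by rewrite inE.
  have xX := closed_nbhd_edge wX wx; have bX := closed_nbhd_edge wX wb.
  move=> z /setU1P [->|/setIP [wz _]].
    by right=> u uB au; case: (Na u uB au) => ->.
  by left; apply: closed_nbhd_edge wX _; rewrite -in_nbhd.
- rewrite -[X in _ * X]cardZ0; apply: sum_charge_le.
  + by rewrite sub1set !inE eqxx.
  + move=> z u /set1P -> uB au.
    by case: (Na u uB au) => ->; rewrite !inE ?wx ?wb ?xB ?bB orbT.
  + move=> z /setU1P [->|/setIP [_ zB]]; first by rewrite !inE eqxx.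
    by move=> _; apply: deg2_setD.
- by apply: charge_out_vertex => // u uB wu; rewrite !inE wu uB orbT.
rewrite cardZ cards1; move: dw.
by case: (deg_in B w) => [|[|[|[|[|k]]]]].
Qed.

(** A second neighbour of [w] on the cycle is not next to [x], which is the previous case up to
    reflection. Otherwise [w] and [b] settle the cycle and the d neighbours of [w]: d + 4 vertices,
    of which d - 1 are charged at most 12. *)
Lemma good_C5_many w x : w \notin B -> 3 <= deg_in B w <= 4 ->
  e w x -> isC5 B x -> good B.
Proof.
move=> wB dw wx /isC5P [a [b [c [d p]]]].
have [wb|nwb] := boolP (e w b); first exact: (good_C5_twice wB dw p).
have [wc|nwc] := boolP (e w c).
  exact: (good_C5_twice wB dw (pentagon_rev p)).
have /pentagonP [[xB aB bB cB dB] [xa ab bc cd dx]] := p.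
pose C := set5 x a b c d; pose Z := (N w :&: B) :|: C.
have NC : (N w :&: B) :&: C = [set x].
  apply/setP => u; apply/idP/set1P => [|->]; last by rewrite !inE wx xB eqxx.
  rewrite in_setI => /andP []; rewrite in_setI in_nbhd => /andP [wu uB].
  case/set5P => [|E|E|[E|E]] //; subst u.
  - by case: (no_triangle wx xa wu).
  - by rewrite wu in nwb.
  - by rewrite wu in nwc.
  - by case: (no_triangle wu dx wx).
have cardZ : #|Z| = deg_in B w + 4.
  by rewrite cardsU NC cards1 (card_pentagon p) -addnBA.
have CZ : C \subset Z by apply: subsetUr.
have cardZ0 : #|Z :\: C| = (deg_in B w).-1.
  rewrite cardsD (setIidPr CZ) cardZ (card_pentagon p).
  by rewrite (subnDA 4 _ 1) addnK subn1.
apply: (@good_reduce B [set w; b] Z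
  (charge 2 * (deg_in B w).-1) (charge (deg_in B w))) => //.
- by rewrite subUset subsetIr (pentagon_sub p).
- by rewrite cardZ addn4.
- have wX : w \in [set w; b] by rewrite !inE eqxx.
  move=> z /setUP [/setIP [wz _]|]; last exact: pentagon_settled.
  by left; apply: closed_nbhd_edge wX _; rewrite -in_nbhd.
- rewrite -[X in _ * X]cardZ0; apply: sum_charge_le => //.
    move=> z u zC uB zu; apply/setUP; right.
    exact: (pentagon_closed deg2 p zC uB).
  move=> z /setUP [/setIP [_ zB]|->] // _; exact: deg2_setD.
- by apply: charge_out_vertex => // u uB wu; rewrite !inE wu uB.
rewrite cardZ cards2; move: dw.
by case: (deg_in B w) => [|[|[|[|[|k]]]]] //; case: (w != b).
Qed.

(** The excess of [weight] over 36 is 24, 12 or 4. It is spread over the edges leaving [B], at least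
    3 for a K2 vertex and at least 2 otherwise. *)
Definition share x := if isK2 B x then 8 else if isC5 B x then 6 else 2.

Lemma weight_share x : x \in B ->
  weight B x <= 36 + share x * #|N x :&: ~: B|.
Proof.
move=> xB; have := deg_out B x; have := deg2 xB; rewrite /weight /share.
case: ifP => [/isK2P [y [_ _ dx _]]|_]; last by case: ifP => _; lia.
by rewrite dx; lia.
Qed.

Lemma good_or_shares w : w \notin B -> deg_in B w <= 4 ->
  good B \/ \sum_(x in N w :&: B) share x <= charge (deg_in B w).
Proof.
move=> wB deg4; have [ge3|lt3] := leqP 3 (deg_in B w).
  have dw : 3 <= deg_in B w <= 4 by rewrite ge3.
  have [/existsP [x /and3P [xB wx bad]]|nobad] :=
      boolP [exists x, [&& x \in B, e w x & isK2 B x || isC5 B x]].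
    left; case/orP: bad => [xK|xC].
      exact: (good_K2_many wB dw xB wx).
    exact: (good_C5_many wB dw wx).
  right; apply: (@leq_trans (\sum_(x in N w :&: B) 2)).
    apply: leq_sum => x; rewrite in_setI in_nbhd => /andP [wx xB].
    have : ~~ (isK2 B x || isC5 B x).
      by apply: contra nobad => bad; apply/existsP; exists x; rewrite xB wx.
    by rewrite negb_or /share => /andP [/negbTE -> /negbTE ->].
  rewrite sum_nat_const -/(deg_in B w).
  by move: dw; case: (deg_in B w) => [|[|[|[|[|k]]]]].
have share8 x : share x <= 8 by rewrite /share; case: ifP => // _; case: ifP.
(* With two neighbours [w] affords 12: the shares 6 + 6 and 8 + 2 fit, while 8 + 8 and 8 + 6 call
   for a reduction. *)
have [dw|n2] := eqVneq (deg_in B w) 2; last first.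
  right; apply: (@leq_trans (\sum_(x in N w :&: B) 8)); first exact: leq_sum.
  rewrite sum_nat_const -/(deg_in B w).
  by move: lt3 n2; case: (deg_in B w) => [|[|[]]].
have /cards2P [x [y [nxy E]]] : #|N w :&: B| == 2 by rewrite -dw.
have /setIP [] : x \in N w :&: B by rewrite E !inE eqxx.
have /setIP [] : y \in N w :&: B by rewrite E !inE eqxx orbT.
rewrite !in_nbhd => wy yB wx xB.
have nyx : y != x by rewrite eq_sym.
rewrite dw E big_setU1 ?inE // big_set1 /share.
case xK: (isK2 B x); case yK: (isK2 B y).
- by left; apply: (good_K2_K2 xB yB nxy wx wy).
- by case: ifP => yC; [left; apply: (good_K2_C5 xB wx wy)|right].
- by case: ifP => xC; [left; apply: (good_K2_C5 yB wy wx)|right].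
- by right; case: ifP; case: ifP.
Qed.

Lemma good_deg2 : (forall w, w \notin B -> deg_in B w <= 4) -> good B.
Proof.
move=> deg4.
have [bad|le] := boolP [exists w, (w \notin B) &&
    (charge (deg_in B w) < \sum_(x in N w :&: B) share x)].
  case/existsP: bad => w /andP [wB lt].
  by case: (good_or_shares wB (deg4 w wB)) => //; rewrite leqNgt lt.
have [X isoX leX] := isolates_sum_weight deg2.
exists X => //; apply: leq_trans leX _; rewrite /potential.
apply: (@leq_trans (\sum_(x in B) (36 + share x * #|N x :&: ~: B|))).
  by apply: leq_sum => x; apply: weight_share.
(* The shares are regrouped by their outside ends, each of which pays from its charge. *)
rewrite big_split /= sum_nat_const mulnC leq_add2l -exchange_edges.
apply: leq_sum => w; rewrite inE => wB; rewrite leqNgt.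
by apply: contra le => lt; apply/existsP; exists w; rewrite wB.
Qed.

End DegreeTwo.

(** * The induction and the final bound *)

Lemma all_good B : good B.
Proof.
have [n] := ubnP #|B|; elim: n B => // n IHn B leBn.
have IH : good_below B.
  by move=> B' lt; apply: IHn; apply: leq_trans lt _; rewrite -ltnS.
have [/existsP [v0 /andP [v0B d0]]|nd4] :=
    boolP [exists v, (v \in B) && (4 <= deg_in B v)].
  case: (@arg_maxnP T v0 (mem B) (deg_in B) v0B) => v vB maxv.
  by apply: (@good_deg_ge4 B v) => //; apply: leq_trans d0 (maxv _ v0B).
have deg3 x : x \in B -> deg_in B x <= 3.
  move=> xB; rewrite leqNgt; apply: contra nd4 => dx.
  by apply/existsP; exists x; rewrite xB.
have [/existsP [w /andP [wB dw]]|nd5] :=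
    boolP [exists w, (w \notin B) && (5 <= deg_in B w)].
  exact: (good_out_ge5 IH deg3 wB dw).
have deg4 w : w \notin B -> deg_in B w <= 4.
  move=> wB; rewrite leqNgt; apply: contra nd5 => dw.
  by apply/existsP; exists w; rewrite wB.
have [/existsP [v /andP [vB /eqP dv]]|nd3] :=
    boolP [exists v, (v \in B) && (deg_in B v == 3)].
  exact: (good_deg3 IH deg3 deg4 vB dv).
apply: good_deg2 => // x xB; have := deg3 x xB.
rewrite leq_eqVlt => /orP [dx|//]; case/existsP: nd3.
by exists x; rewrite xB.
Qed.

End Isolation.

Theorem theorem3 (T : finType) (e : rel T)
    (e_sym : symmetric e) (e_irr : irreflexive e)
    (tri_free : triangle_free e)
    (min_deg : forall v : T, 4 <= deg e v) :
  ((isolation_number e)%:R <= 3%:R / 10%:R * #|T|%:R :> rat)%R.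
Proof.
have [X isoX leX] := all_good e_sym tri_free min_deg [set: T].
have isolX : isolating e X.
  apply/forall_inP => x; rewrite inE => xX.
  apply/forall_inP => y; rewrite inE => yX; apply/negP => xy.
  by case: (isoX x y) => //; [rewrite (negbTE xX)|rewrite (negbTE yX)].
have [_ /(_ X isolX) le_iso] := isolation_numberP e.
(* For the full vertex set no vertex is outside, so the potential is 36 times the order; dividing by
   12 gives the bound. *)
have le : 10 * isolation_number e <= 3 * #|T|.
  move: leX; rewrite /potential setCT big_set0 cardsT; lia.
rewrite -(@Num.Theory.ler_nat rat) !GRing.natrM in le.
rewrite GRing.mulrAC Num.Theory.ler_pdivlMr ?Num.Theory.ltr0n //.
by rewrite GRing.mulrC.
Qed.
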